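(* Consider the scalar quadratic cheap talk game with a real-valued source $m$, bias $b\in\mathbb{R}$, encoder cost $c^e(m,u)=(m-u-b)^2$ and decoder cost $c^d(m,u)=(m-u)^2$, played sequentially with the encoder as leader. Then the Stackelberg equilibrium is unique and corresponds to a fully revealing (fully informative) encoder policy.
   Context: The encoder observes $m$ and sends $x=\gamma^e(m)$, where $\gamma^e$ is a measurable deterministic function from $\mathbb{R}$ to the message space $\mathbb{X}$ (take $\mathbb{X}=\mathbb{R}$); the decoder receives $x$ without noise and chooses $u=\gamma^d(x)\in\mathbb{R}$ with $\gamma^d$ measurable. The costs are $J^e(\gamma^e,\gamma^d)=\mathbb{E}[(m-u-b)^2]$ and $J^d(\gamma^e,\gamma^d)=\mathbb{E}[(m-u)^2]$, both to be minimized. Stackelberg equilibrium: the encoder's policy is announced first and the decoder best-responds to it. A pair $(\gamma^{*,e},\gamma^{*,d})$ is a Stackelberg equilibrium if $J^e(\gamma^{*,e},\gamma^{*,d}(\gamma^{*,e}))\le J^e(\gamma^e,\gamma^{*,d}(\gamma^e))$ for all encoder policies $\gamma^e$, where $\gamma^{*,d}(\gamma^e)$ satisfies $J^d(\gamma^e,\gamma^{*,d}(\gamma^e))\le J^d(\gamma^e,\gamma^d(\gamma^e))$ for all decoder policies $\gamma^d$. An encoder policy is fully revealing (fully informative) if it reveals all of the encoder's information, i.e., the source $m$ can be recovered almost surely from the message $x=\gamma^e(m)$. *)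

(* Defs.v *)
From HB Require Import structures.
From mathcomp Require Import all_boot all_order all_algebra.
From mathcomp Require Import all_classical all_reals all_analysis.

Set Implicit Arguments.
Unset Strict Implicit.
Unset Printing Implicit Defensive.

Import Order.TTheory GRing.Theory Num.Theory.
Import numFieldNormedType.Exports.

Local Open Scope classical_set_scope.
Local Open Scope ring_scope.

Definition encoder_policy (R : realType) := {mfun R >-> R}.
Definition decoder_policy (R : realType) := {mfun R >-> R}.

Definition encoder_cost (R : realType) (b m u : R) : R := (m - u - b) ^+ 2.
Definition decoder_cost (R : realType) (m u : R) : R := (m - u) ^+ 2.

(* The expectations of these nonnegative costs live in \bar R, so no moment
   condition on the source is needed and +oo is a legitimate value. *)
Definition Je (d : measure_display) (T : measurableType d) (R : realType)
    (P : probability T R) (m : {RV P >-> R}) (b : R)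
    (e : encoder_policy R) (g : decoder_policy R) : \bar R :=
  'E_P[fun w => encoder_cost b (m w) (g (e (m w)))].

Definition Jd (d : measure_display) (T : measurableType d) (R : realType)
    (P : probability T R) (m : {RV P >-> R})
    (e : encoder_policy R) (g : decoder_policy R) : \bar R :=
  'E_P[fun w => decoder_cost (m w) (g (e (m w)))].

Definition best_response (d : measure_display) (T : measurableType d)
    (R : realType) (P : probability T R) (m : {RV P >-> R})
    (e : encoder_policy R) (g : decoder_policy R) : Prop :=
  forall g' : decoder_policy R, (Jd m e g <= Jd m e g')%E.

(* As the encoder commits first, the decoder's strategy is a map [D] from
   announced encoder policies to decoder policies. *)
Definition stackelberg (d : measure_display) (T : measurableType d)
    (R : realType) (P : probability T R) (m : {RV P >-> R}) (b : R)
    (e : encoder_policy R) (D : encoder_policy R -> decoder_policy R) : Prop :=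
  (forall e' : encoder_policy R, best_response m e' (D e')) /\
  (forall e' : encoder_policy R, (Je m b e (D e) <= Je m b e' (D e'))%E).

Definition fully_revealing (d : measure_display) (T : measurableType d)
    (R : realType) (P : probability T R) (m : {RV P >-> R})
    (e : encoder_policy R) : Prop :=
  exists h : {mfun R >-> R}, {ae P, forall w, h (e (m w)) = m w}.

(* Each message can be computed almost surely from the other one. *)
Definition same_information (d : measure_display) (T : measurableType d)
    (R : realType) (P : probability T R) (m : {RV P >-> R})
    (e1 e2 : encoder_policy R) : Prop :=
  (exists h : {mfun R >-> R}, {ae P, forall w, h (e1 (m w)) = e2 (m w)}) /\
  (exists h : {mfun R >-> R}, {ae P, forall w, h (e2 (m w)) = e1 (m w)}).

(* Equality of equilibria can only be meant up to relabelling of the messages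
   (an injective measurable change of the message does not affect the game), up
   to null sets, and irrespective of the replies to encoder policies that are
   not the announced one. *)
Definition same_equilibrium (d : measure_display) (T : measurableType d)
    (R : realType) (P : probability T R) (m : {RV P >-> R})
    (e1 : encoder_policy R) (D1 : encoder_policy R -> decoder_policy R)
    (e2 : encoder_policy R) (D2 : encoder_policy R -> decoder_policy R)
    : Prop :=
  same_information m e1 e2 /\
  {ae P, forall w, D1 e1 (e1 (m w)) = D2 e2 (e2 (m w))}.

(* Main.v *)
Require Import Defs.
From HB Require Import structures.
From mathcomp Require Import all_boot all_order all_algebra.
From mathcomp Require Import all_classical all_reals all_analysis.
From mathcomp Require Import measurable_realfun ring lra.

(** At a best response the error m - u has mean zero, since otherwise shifting
    the reply by that mean would lower the decoder's cost.  Hence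
    Je = Jd + b^2 whatever the announced policy, and the encoder minimises Jd,
    just like the decoder; its minimum 0 is attained exactly when the reply
    recovers m almost surely.

    Since the decoder's strategy must answer every announced policy, best
    responses have to exist for all of them, without any moment assumption on
    m.  If some reply g0 has finite cost, a best response is g0 plus the
    conditional expectation of the square-integrable error m - g0(x) given x;
    if none has, every reply is a best response. *)

Set Implicit Arguments.
Unset Strict Implicit.
Unset Printing Implicit Defensive.

Import Order.TTheory GRing.Theory Num.Theory.
Import numFieldNormedType.Exports HBNNSimple.

Local Open Scope classical_set_scope.
Local Open Scope ring_scope.

(** * Square-integrable functions on a probability space *)

Lemma integrable_mul_bounded d (T : measurableType d) (R : realType)
    (mu : {measure set T -> \bar R}) (Z f : T -> R) (M : R) :
  mu.-integrable setT (EFin \o Z) -> measurable_fun setT f ->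
  (forall x, `|f x| <= M) -> mu.-integrable setT (fun x => (Z x * f x)%:E).
Proof.
move=> iZ mf fM; rewrite (_ : (fun x => _) = ((EFin \o Z) \* (EFin \o f))%E) //.
apply: integrableMl => //; exists M; split; first exact: num_real.
by move=> N MN x _ /=; rewrite (le_trans (fM x)) ?ltW.
Qed.

Lemma integrable_sqr d (T : measurableType d) (R : realType)
    (mu : {measure set T -> \bar R}) (V : T -> R) :
  measurable_fun setT V -> (\int[mu]_x ((V x) ^+ 2)%:E < +oo)%E ->
  mu.-integrable setT (fun x => ((V x) ^+ 2)%:E).
Proof.
move=> mV fV; apply/integrableP; split.
  by apply/measurable_EFinP; exact: measurable_funX.
by under eq_integral do rewrite gee0_abs ?lee_fin ?sqr_ge0//.
Qed.

Lemma integrable_of_sqr d (T : measurableType d) (R : realType)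
    (P : probability T R) (V : T -> R) :
  measurable_fun setT V -> (\int[P]_x ((V x) ^+ 2)%:E < +oo)%E ->
  P.-integrable setT (EFin \o V).
Proof.
move=> mV fV.
have iV2 := integrable_sqr mV fV.
(* The dominating function comes from [|V| <= 1 + V ^+ 2]; the constant is integrable because [P] is
   finite. *)
have i1 : P.-integrable setT (fun x => (1 + V x ^+ 2)%:E).
  under eq_fun do rewrite EFinD.
  by apply: integrableD => //; exact: finite_measure_integrable_cst.
apply: (le_integrable _ _ _ i1) => //; first exact/measurable_EFinP.
move=> x _ /=; rewrite lee_fin [leRHS]ger0_norm ?addr_ge0 ?sqr_ge0//.
by rewrite -[V x ^+ 2]real_normK ?num_real//; have := sqr_ge0 (`|V x| - 1); nra.
Qed.

(** Expanding the square, where the finite second moment lets the integral be split. The shift [c]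
    will be the bias, its opposite, or the mean error of a reply. *)
Lemma integral_sqr_shift d (T : measurableType d) (R : realType)
    (P : probability T R) (V : T -> R) (c : R) :
  measurable_fun setT V -> (\int[P]_x ((V x) ^+ 2)%:E < +oo)%E ->
  (\int[P]_x ((V x - c) ^+ 2)%:E = \int[P]_x ((V x) ^+ 2)%:E +
     (c ^+ 2 - 2 * c * fine (\int[P]_x (V x)%:E))%:E)%E.
Proof.
move=> mV fV.
have iV2 := integrable_sqr mV fV.
have iV := integrable_of_sqr mV fV.
have icV : P.-integrable setT (fun x => (- (2 * c) * V x)%:E).
  by under eq_fun do rewrite EFinM; exact: integrableZl.
have ic : P.-integrable setT (fun x => (c ^+ 2)%:E).
  exact: finite_measure_integrable_cst.
have -> : (fun x => ((V x - c) ^+ 2)%:E) =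
    (fun x => (V x ^+ 2)%:E + ((c ^+ 2)%:E + (- (2 * c) * V x)%:E))%E.
  by apply/funext => x; rewrite -!EFinD; congr EFin; ring.
rewrite integralD//=; last exact: integrableD.
rewrite integralD//= integral_cst//= probability_setT mule1.
under [X in (_ + (_ + X))%E]eq_integral do rewrite EFinM.
rewrite integralZl//= -[X in (_%:E * X)%E]fineK ?integrable_fin_num//.
by rewrite -EFinM -EFinD; congr (_ + _%:E)%E; ring.
Qed.

(** * Conditional expectation and least-squares prediction *)

Section conditional_expectation.
Context d1 d2 (T1 : measurableType d1) (T2 : measurableType d2) (R : realType).
Variables (P : probability T1 R) (X : {mfun T1 >-> T2}).
Local Open Scope ereal_scope.

(** [h] is the Radon-Nikodym derivative, with respect to the law of [X], of the image under [X] of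
    the charge with density [Y]. Differentiating on [T2] rather than on [T1] yields a function of
    the value of [X] directly. *)
Lemma conditional_expectation (Y : T1 -> R) :
  P.-integrable setT (EFin \o Y) ->
  exists h : T2 -> R, [/\ measurable_fun setT h,
    P.-integrable setT (EFin \o (h \o X)) &
    forall A, measurable A ->
      \int[P]_(x in X @^-1` A) (Y x)%:E =
      \int[P]_(x in X @^-1` A) (h (X x))%:E].
Proof.
move=> iY.
have mX : measurable_fun setT X by [].
(* Named explicitly: [mX] cannot be inferred from [pushforward _ X]. *)
pose nu : {charge set T2 -> \bar R} :=
  measure_function_pushforward__canonical__charge_Charge (induced_charge iY) mX.
pose mu := distribution P X.
have numu : (nu : set T2 -> \bar R) `<< mu.
  apply: dominates_pushforward => //.
  apply/null_content_dominatesP => A mA PA; rewrite /induced_charge.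
  apply: null_set_integral => //.
  have mY : measurable_fun setT (EFin \o Y) by exact: measurable_int iY.
  exact: measurable_funTS.
pose f := Radon_Nikodym nu mu.
have ffin x : f x \is a fin_num by exact: Radon_Nikodym_fin_num.
have imuf : mu.-integrable setT f by exact: Radon_Nikodym_integrable.
have mf : measurable_fun setT f by exact: measurable_int imuf.
have fE x : (fine (f x))%:E = f x by rewrite fineK.
have iPf : P.-integrable setT (f \o X).
  apply/integrableP; split; first exact: measurableT_comp.
  move/integrableP : imuf => [_]; rewrite ge0_integral_pushforward//.
  exact: measurableT_comp.
exists (fine \o f); split.
- by apply: measurableT_comp.
- by rewrite (_ : EFin \o _ = f \o X)//; apply/funext => x /=; rewrite fE.
- move=> A mA.
  transitivity (nu A) => //.
  rewrite (Radon_Nikodym_integral numu mA).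
  rewrite integral_pushforward//.
    by apply: eq_integral => x _ /=; rewrite fE.
  apply: (integrableS measurableT) => //; exact: measurable_funPTI.
Qed.

(** By linearity: [s] is a finite combination of indicators of its level sets, and [Z] integrates to
    zero over the preimage of each. *)
Lemma integral_mul_nnsfun_eq0 (Z : T1 -> R) (s : {nnsfun T2 >-> R}) :
  P.-integrable setT (EFin \o Z) ->
  (forall A, measurable A -> \int[P]_(x in X @^-1` A) (Z x)%:E = 0) ->
  \int[P]_x (Z x * s (X x))%:E = 0.
Proof.
move=> iZ Z0.
have iZs r : P.-integrable setT
    (fun x => (Z x * (r * \1_(s @^-1` [set r]) (X x)))%:E).
  apply: (integrable_mul_bounded (M := `|r|)) => //.
    apply: measurable_funM => //.
    by apply: measurableT_comp => //.
  move=> x; rewrite normrM indicE; case: (_ \in _) => /=.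
    by rewrite normr1 mulr1.
  by rewrite normr0 mulr0.
under eq_integral => x _.
  rewrite fimfunE fsbig_finite//= mulr_sumr -sumEFin.
  over.
rewrite integral_sum //= big1 => // r _.
have := Z0 (s @^-1` [set r]); rewrite integral_mkcond => /(_ _) Zr.
transitivity
    (r%:E * \int[P]_x ((EFin \o Z) \_ (X @^-1` (s @^-1` [set r]))) x); last first.
  by rewrite Zr ?mule0//; exact: measurable_funPTI.
have mB : measurable (X @^-1` (s @^-1` [set r])).
  by apply: measurable_funPTI => //; exact: measurable_funPTI.
rewrite -integralZl//; last first.
  by rewrite -integrable_mkcond//; exact: integrableS iZ.
apply: eq_integral => x _; rewrite patchE indicE.
have -> : (X x \in s @^-1` [set r]) = (x \in X @^-1` (s @^-1` [set r])).
  by apply/idP/idP; rewrite !inE.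
by case: ifP => _; rewrite ?mulr1 ?mulr0 ?mule0//= mulrC EFinM.
Qed.

(** For nonnegative [f], simple functions increase to [f] and dominated convergence applies with
    bound [M] times the absolute value of [Z]. The general case shifts [f] by [M], which adds
    nothing since [Z] has mean zero. *)
Lemma integral_mul_bounded_eq0 (Z : T1 -> R) (f : T2 -> R) (M : R) :
  P.-integrable setT (EFin \o Z) ->
  (forall A, measurable A -> \int[P]_(x in X @^-1` A) (Z x)%:E = 0) ->
  measurable_fun setT f -> (forall x, (`|f x| <= M)%R) ->
  \int[P]_x (Z x * f (X x))%:E = 0.
Proof.
move=> iZ Z0.
wlog f0 : f M / forall x, (0 <= f x)%R => [ge0 mf fM|mf fM].
  have g0 x : (0 <= f x + M)%R.
    by rewrite -lerBlDr sub0r lerNl (le_trans _ (fM x))// ler_normr lexx orbT.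
  have mg : measurable_fun setT (fun x => f x + M)%R by exact: measurable_funD.
  have /(ge0 _ (M + M)%R g0 mg) : forall x, (`|f x + M| <= M + M)%R.
    by move=> x; rewrite ger0_norm// lerD2r (le_trans (ler_norm _)).
  have iZf : P.-integrable setT (fun x => (Z x * f (X x))%:E).
    apply: (integrable_mul_bounded (M := M)) => //.
    exact: measurableT_comp.
  have iZM : P.-integrable setT (fun x => (M * Z x)%:E).
    by under eq_fun do rewrite EFinM; exact: integrableZl.
  under eq_integral do rewrite mulrDr EFinD (mulrC _ M).
  rewrite integralD//= => <-.
  under [in X in _ = _ + X]eq_integral do rewrite EFinM.
  rewrite integralZl//=.
  by have := Z0 setT measurableT; rewrite preimage_setT => ->; rewrite mule0 adde0.
have mEf : measurable_fun setT (EFin \o f) by exact/measurable_EFinP.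
pose s := nnsfun_approx measurableT mEf.
have sf n x : (s n x <= f x)%R.
  rewrite nnsfun_approxE -lee_fin; apply: (le_approx (f := EFin \o f)) => //.
  by move=> y _; rewrite lee_fin.
have mX : measurable_fun setT X by [].
have mZ : measurable_fun setT Z by apply/measurable_EFinP; exact: measurable_int iZ.
have msX n : measurable_fun setT (fun x => s n (X x)).
  by apply: measurableT_comp.
have mfX : measurable_fun setT (fun x => f (X x)) by exact: measurableT_comp.
have H1 n : measurable_fun setT (fun x => (Z x * s n (X x))%:E).
  by apply/measurable_EFinP; exact: measurable_funM.
have H2 : measurable_fun setT (fun x => (Z x * f (X x))%:E).
  by apply/measurable_EFinP; exact: measurable_funM.
have H3 : {ae P, forall x, setT x ->
    (Z x * s n (X x))%:E @[n --> \oo] --> (Z x * f (X x))%:E}.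
  apply: aeW => x _; under eq_fun do rewrite EFinM.
  rewrite EFinM; apply: cvgeZl => //.
  by apply: (cvg_nnsfun_approx _ mEf) => // y _; rewrite lee_fin.
have H4 : P.-integrable setT (fun x => (`|Z x| * M)%:E).
  under eq_fun do rewrite mulrC EFinM.
  by apply: integrableZl => //; exact: integrable_norm.
have H5 : {ae P, forall x n, setT x ->
    `|(Z x * s n (X x))%:E| <= (`|Z x| * M)%:E}.
  apply: aeW => x n _; rewrite /= lee_fin normrM ler_wpM2l// ger0_norm//.
  by rewrite (le_trans (sf _ _))// (le_trans (ler_norm _)).
have [_ _] := dominated_convergence measurableT H1 H2 H3 H4 H5.
under eq_fun do rewrite integral_mul_nnsfun_eq0//.
by move=> /cvg_lim <- //; rewrite lim_cst.
Qed.

(* The minimiser is the conditional expectation [h] of [Y].  It is only known to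
   be integrable, and the competitor [k] is arbitrary, so the Pythagorean
   comparison is made on the sets [A n] where both are bounded by [n]. *)
Lemma mean_square_minimizer (Y : T1 -> R) :
  measurable_fun setT Y -> \int[P]_x ((Y x) ^+ 2)%:E < +oo ->
  exists2 h : T2 -> R, measurable_fun setT h &
    forall k : T2 -> R, measurable_fun setT k ->
      \int[P]_x ((Y x - h (X x)) ^+ 2)%:E <=
      \int[P]_x ((Y x - k (X x)) ^+ 2)%:E.
Proof.
move=> mY fY.
have iY := integrable_of_sqr mY fY.
have [h [mh ih hE]] := conditional_expectation iY.
exists h => // k mk.
have mX : measurable_fun setT X by [].
have mhX : measurable_fun setT (fun x => h (X x)) by exact: measurableT_comp.
have mkX : measurable_fun setT (fun x => k (X x)) by exact: measurableT_comp.
pose Z x := (Y x - h (X x))%R.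
pose W x := (Y x - k (X x))%R.
have mZ : measurable_fun setT Z by exact: measurable_funB.
have mW : measurable_fun setT W by exact: measurable_funB.
have [Woo|] := ltP (\int[P]_x ((W x) ^+ 2)%:E) +oo; last first.
  by rewrite leye_eq => /eqP ->; rewrite leey.
have iW2 := integrable_sqr mW Woo.
have iZ : P.-integrable setT (EFin \o Z).
  rewrite (_ : EFin \o Z = (EFin \o Y) \- (EFin \o (h \o X))) //.
  exact: integrableB.
have Z0 A : measurable A -> \int[P]_(x in X @^-1` A) (Z x)%:E = 0.
  move=> mA; have mXA : measurable (X @^-1` A) by exact: measurable_funPTI.
  under eq_integral do rewrite EFinB.
  rewrite integralB//; [|exact: integrableS iY|exact: integrableS ih].
  by rewrite hE// subee// integrable_fin_num//; exact: integrableS ih.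
pose A (n : nat) := [set x | (`|h x| <= n%:R)%R] `&` [set x | (`|k x| <= n%:R)%R].
have mA n : measurable (A n).
  have mle (u : T2 -> R) : measurable_fun setT u ->
      measurable [set x | (`|u x| <= n%:R)%R].
    move=> mu.
    rewrite (_ : [set _ | _] = [set: T2] `&` (Num.norm \o u) @^-1` `]-oo, n%:R]).
      by apply: measurableT_comp => //; exact: measurable_itv.
    by rewrite setTI; apply/seteqP; split => x /=; rewrite in_itv.
  by apply: measurableI; exact: mle.
(* Truncated difference of the two predictors: it is bounded, so the error [Z] is orthogonal to
   it. *)
pose f n x := ((h x - k x) * \1_(A n) x)%R.
have mf n : measurable_fun setT (f n).
  by apply: measurable_funM => //; exact: measurable_funB.
have fb n x : (`|f n x| <= n%:R + n%:R)%R.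
  rewrite /f normrM indicE; case: (boolP (x \in A n)) => [|_].
    rewrite inE => -[] /= hn kn.
    by rewrite normr1 mulr1 (le_trans (ler_normB _ _))// lerD.
  by rewrite normr0 mulr0 addr_ge0.
have Zf n := integral_mul_bounded_eq0 iZ Z0 (mf n) (fb n).
have mfX n : measurable_fun setT (fun x => f n (X x)) by exact: measurableT_comp.
have iZf n : P.-integrable setT (fun x => (Z x * f n (X x))%:E).
  exact: (integrable_mul_bounded (M := (n%:R + n%:R)%R)).
pose g n x := (Z x ^+ 2 * \1_(A n) (X x))%:E.
have mg n : measurable_fun setT (g n).
  apply/measurable_EFinP/measurable_funM; first exact: measurable_funX.
  by apply: measurableT_comp => //; exact: measurable_indic.
have g0 n x : 0 <= g n x by rewrite lee_fin mulr_ge0// ?sqr_ge0 ?indicE.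
have gW n : \int[P]_x g n x <= \int[P]_x (W x ^+ 2)%:E.
  have i2 : P.-integrable setT (fun x => (2 * (Z x * f n (X x)))%:E).
    by under eq_fun do rewrite EFinM; exact: integrableZl.
  (* Subtracting the cross term, of integral zero, makes the comparison pointwise: on [A n] the
     right side exceeds [Z ^+ 2] by [(h - k) ^+ 2], and off [A n] it is [W ^+ 2] against 0. *)
  have -> : \int[P]_x (W x ^+ 2)%:E =
      \int[P]_x (W x ^+ 2 - 2 * (Z x * f n (X x)))%:E.
    under [RHS]eq_integral do rewrite EFinB.
    rewrite integralB//=.
    under [X in _ = _ - X]eq_integral do rewrite EFinM.
    by rewrite integralZl//= Zf mule0 sube0.
  apply: ge0_le_integral => //.
    apply/measurable_EFinP/measurable_funB; first exact: measurable_funX.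
    by apply: measurable_funM => //; exact: measurable_funM.
  move=> x _; rewrite lee_fin.
  rewrite (_ : W x = Z x + (h (X x) - k (X x)))%R; last by rewrite /W /Z; ring.
  rewrite /f indicE; case: (_ \in _) => /=; rewrite ?mulr1 ?mulr0 ?subr0 ?sqr_ge0//.
  by have := sqr_ge0 (h (X x) - k (X x)); nra.
have gE x : limn (g ^~ x) = (Z x ^+ 2)%:E.
  apply/cvg_lim => //; apply: cvg_near_cst.
  near=> n; rewrite /g indicE mem_set ?mulr1//; split => /=.
    by near: n; exact: nbhs_infty_ger.
  by near: n; exact: nbhs_infty_ger.
have ndg n p x : (n <= p)%N -> g n x <= g p x.
  move=> np; rewrite lee_fin ler_wpM2l ?sqr_ge0//.
  rewrite !indicE; case: (boolP (X x \in A n)) => // /[!inE] -[] /= hn kn.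
  by rewrite mem_set//; split => /=; rewrite (le_trans hn, le_trans kn) ?ler_nat.
(* The sets [A n] increase to the whole space, so the bound on each of them passes to the limit by
   monotone convergence. *)
under eq_integral do rewrite -[((Y _ - _) ^+ 2)%:E]gE.
rewrite monotone_convergence//.
  apply: lime_le.
    apply: ereal_nondecreasing_is_cvgn => n p np.
    by apply: ge0_le_integral => // x _; exact: ndg.
  by apply: nearW => n; exact: gW.
by move=> x _ n p np; exact: ndg.
Unshelve. all: by end_near. Qed.

End conditional_expectation.

(** * Best responses and equilibria of the cheap talk game *)

Definition reveal (R : realType) : {mfun R >-> R} :=
  mfun_Sub (mem_set (@measurable_id _ R setT)).

Section cheap_talk.
Context d (T : measurableType d) (R : realType).
Variables (P : probability T R) (m : {RV P >-> R}) (b : R).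
Implicit Types (e : encoder_policy R) (g : decoder_policy R).
Local Open Scope ereal_scope.

Let measurable_error e g : measurable_fun setT (fun w => m w - g (e (m w)))%R.
Proof.
apply: measurable_funB => //; apply: measurableT_comp => //.
exact: measurableT_comp.
Qed.

Lemma best_response_exists e : exists g, best_response m e g.
Proof.
have [[g0 g0fin]|noreply] := pselect (exists g, Jd m e g < +oo); last first.
  (* Any reply would do here; [e] is at hand, since encoder and decoder policies have the same
     type. *)
  exists e => g'; suff -> : Jd m e g' = +oo by rewrite leey.
  apply/eqP; rewrite -leye_eq leNgt; apply/negP => g'fin.
  by apply: noreply; exists g'.
have mem : (e \o m) \in mfun by rewrite inE; exact: measurableT_comp.
have := g0fin; rewrite /Jd unlock.
pose X : {mfun T >-> R} := mfun_Sub mem.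
move=> /(@mean_square_minimizer _ _ _ _ _ P X _ (measurable_error e g0)).
move=> [h mh hmin].
have mg : (g0 \+ h)%R \in mfun by rewrite inE; exact: measurable_funD.
exists (mfun_Sub mg) => g'; rewrite /Jd unlock.
(* A competing reply [g'] amounts to predicting the error of [g0] by [g' - g0]. *)
have /hmin : measurable_fun setT (g' \- g0)%R by exact: measurable_funB.
by congr (_ <= _); apply: eq_integral => w _ /=;
  rewrite /decoder_cost /=; congr (_ ^+ 2)%:E; ring.
Qed.

Lemma Je_best_response e g : best_response m e g ->
  Je m b e g = Jd m e g + (b ^+ 2)%:E.
Proof.
move=> eg; rewrite /Je /Jd unlock.
set V := (fun w => m w - g (e (m w)))%R.
have mV : measurable_fun setT V by exact: measurable_error.
rewrite -[LHS]/(\int[P]_w ((V w - b) ^+ 2)%:E).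
rewrite -[X in _ = X + _]/(\int[P]_w (V w ^+ 2)%:E).
have [Voo|] := ltP (\int[P]_w (V w ^+ 2)%:E) +oo; last first.
  rewrite leye_eq => /eqP Voo.
  rewrite Voo addye//; apply/eqP; rewrite -leye_eq leNgt; apply/negP => Vboo.
  have mVb : measurable_fun setT (fun w => V w - b)%R by exact: measurable_funB.
  (* Shifting [V - b] back by [- b] would make the second moment of [V] finite, against [Voo]. *)
  have := integral_sqr_shift (- b) mVb Vboo.
  under eq_integral do rewrite opprK subrK.
  rewrite Voo => /esym/eqP.
  have : \int[P]_w ((V w - b) ^+ 2)%:E \is a fin_num.
    by rewrite ge0_fin_numE// integral_ge0// => w _; rewrite lee_fin sqr_ge0.
  by move=> /fineK <-.
rewrite (integral_sqr_shift _ mV Voo).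
set mean := fine _.
suff -> : mean = 0%R by rewrite mulr0 subr0.
(* Adding [mean] to the reply changes the decoder's cost by [- mean ^+ 2], which optimality of [g]
   forces to be nonnegative. *)
have mg : (g \+ cst mean)%R \in mfun by rewrite inE; exact: measurable_funD.
have := eg (mfun_Sub mg); rewrite /Jd unlock.
have -> : \int[P]_w (decoder_cost (m w) (mfun_Sub mg (e (m w))))%:E =
    \int[P]_w ((V w - mean) ^+ 2)%:E.
  by apply: eq_integral => w _ /=; rewrite /decoder_cost /V /=; congr (_ ^+ 2)%:E; ring.
rewrite (integral_sqr_shift _ mV Voo) -/mean.
have Vfin : \int[P]_w (V w ^+ 2)%:E \is a fin_num.
  by rewrite ge0_fin_numE// integral_ge0// => w _; rewrite lee_fin sqr_ge0.
rewrite -[X in X <= _]adde0 leeD2lE// lee_fin => mean_le0.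
by apply/eqP; rewrite -sqrf_eq0 eq_le sqr_ge0 andbT; nra.
Qed.

Lemma Jd_ge0 e g : 0 <= Jd m e g.
Proof. by apply: expectation_ge0 => w; exact: sqr_ge0. Qed.

Lemma Jd_eq0 e g : Jd m e g = 0 <-> {ae P, forall w, g (e (m w)) = m w}.
Proof.
rewrite /Jd unlock.
have mV2 : measurable_fun setT (fun w => (decoder_cost (m w) (g (e (m w))))%:E).
  by apply/measurable_EFinP/measurable_funX; exact: measurable_error.
have := ae_eq_integral_abs P measurableT mV2.
under eq_integral do rewrite gee0_abs ?lee_fin ?sqr_ge0//.
move=> ->; split; apply: filterS => w /=.
  by move=> /(_ I)/eqP; rewrite eqe sqrf_eq0 subr_eq0 => /eqP.
by move=> -> _; rewrite /decoder_cost subrr expr0n.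
Qed.

Lemma Je_ge e g : best_response m e g -> (b ^+ 2)%:E <= Je m b e g.
Proof. by move=> /Je_best_response ->; rewrite leeDr// Jd_ge0. Qed.

(** The function that recovers the source is itself an admissible reply, of cost zero. *)
Lemma fully_revealing_best_response e g : fully_revealing m e ->
  best_response m e g -> Jd m e g = 0.
Proof.
move=> [h /Jd_eq0 h0] /(_ h); rewrite h0 => Jle.
by apply/eqP; rewrite eq_le Jle Jd_ge0.
Qed.

Lemma reveal_fully_revealing : fully_revealing m (reveal R).
Proof. by exists (reveal R); exact: aeW. Qed.

(** Deviating to [reveal] costs the encoder exactly [b ^+ 2]; cancelling this term on both sides
    bounds the decoder's cost by 0. *)
Lemma stackelberg_Jd0 e D : stackelberg m b e D -> Jd m e (D e) = 0.
Proof.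
move=> [br /(_ (reveal R))].
rewrite !Je_best_response// (fully_revealing_best_response reveal_fully_revealing)//.
rewrite add0e -[leRHS]add0e leeD2rE// => Jle.
by apply/eqP; rewrite eq_le Jle Jd_ge0.
Qed.

(** The axiom of choice assembles best responses into a strategy [D]. Against it [e] attains
    [b ^+ 2], a lower bound for every announced policy. *)
Lemma fully_revealing_stackelberg e :
  fully_revealing m e -> exists D, stackelberg m b e D.
Proof.
move=> em; have /choice[D br] := best_response_exists.
exists D; split=> // e'.
by rewrite Je_best_response// fully_revealing_best_response// add0e Je_ge.
Qed.

Lemma stackelberg_recovers e D : stackelberg m b e D ->
  {ae P, forall w, D e (e (m w)) = m w}.
Proof. by move=> /stackelberg_Jd0/Jd_eq0. Qed.

End cheap_talk.

Theorem mainTheorem2 (d : measure_display) (T : measurableType d)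
    (R : realType) (P : probability T R) (m : {RV P >-> R}) (b : R) :
  (exists (e : encoder_policy R) (D : encoder_policy R -> decoder_policy R),
     stackelberg m b e D) /\
  (forall (e1 : encoder_policy R) (D1 : encoder_policy R -> decoder_policy R)
          (e2 : encoder_policy R) (D2 : encoder_policy R -> decoder_policy R),
     stackelberg m b e1 D1 -> stackelberg m b e2 D2 ->
     same_equilibrium m e1 D1 e2 D2) /\
  (forall e : encoder_policy R,
     (exists D : encoder_policy R -> decoder_policy R, stackelberg m b e D) <->
     fully_revealing m e).
Proof.
split; [|split].
- exists (reveal R).
  exact/fully_revealing_stackelberg/reveal_fully_revealing.
- move=> e1 D1 e2 D2 /stackelberg_recovers r1 /stackelberg_recovers r2.
  (* A reply that recovers the source from one message, followed by the other encoder, computes the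
     other message. *)
  have recode (e e' : encoder_policy R) (g : decoder_policy R) :
      {ae P, forall w, g (e (m w)) = m w} ->
      exists h : {mfun R >-> R}, {ae P, forall w, h (e (m w)) = e' (m w)}.
    have mh : (e' \o g) \in mfun by rewrite inE; exact: measurableT_comp.
    by move=> ge; exists (mfun_Sub mh); apply: filterS ge => w /= ->.
  split; first by split; apply: recode; eassumption.
  by apply: filterS2 r1 r2 => w -> ->.
- move=> e; split=> [[D /stackelberg_recovers eD]|]; first by exists (D e).
  exact: fully_revealing_stackelberg.
Qed.
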